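(* For every $2$-edge coloring $c:[\omega_1]^2\to\{0,1\}$ of the complete graph $K_{\omega_1}=(\omega_1,[\omega_1]^2)$, the vertex set $\omega_1$ can be partitioned into two sets $P^0,P^1$ such that $P^i$ is a path in color $i$ for $i=0,1$.
   Context: $\omega_1$ is the first uncountable ordinal (cardinal). A graph $P=(V,E)$ is a path iff there is a well ordering $\prec$ of $V$ such that for every $v\in V$ the set $\{w\in N_P(v): w\prec v\}$ is $\prec$-cofinal in $\{w\in V: w\prec v\}$ (here $N_P(v)$ is the set of neighbours of $v$ in $P$); for finite graphs this coincides with the usual notion of a path. A set $X$ of vertices is a path in color $i$ if the graph $(X,\{e\in[X]^2: c(e)=i\})$ is a path. The empty set and singletons are paths in any color. *)

(* Defs.v *)
From mathcomp Require Import all_boot.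
From mathcomp Require Import boolp wochoice classical_sets functions cardinality.

Set Implicit Arguments.
Unset Strict Implicit.
Unset Printing Implicit Defensive.

Local Open Scope classical_set_scope.

(* Well orders are non-strict relations, as in [wochoice]: [well_order R] for a
   well order of a whole type, [{in <= X, well_order R}] for one of a set [X]. *)
Definition strict (T : Type) (R : rel T) (x y : T) : Prop := R x y /\ x <> y.

(* [R] orders [W] in type omega_1, i.e. [(W, R)] is, up to isomorphism, the
   least uncountable ordinal; see [omega1_order_exists]. *)
Definition omega1_order (W : Type) (R : rel W) : Prop :=
  [/\ well_order R,
      ~ countable [set: W]
    & forall x : W, countable [set y | strict R y x]].

(* The edge set of the complete graph on [X], written [X]^2 in set theory. *)
Definition pairs (T : Type) (X : set T) : set (set T) :=
  [set e | exists x y : T, [/\ X x, X y, x <> y & e = [set x; y]]].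

Record graph (T : Type) := Graph {
  vertices : set T;
  edges : set (set T);
  edges_sub : edges `<=` pairs vertices }.

Definition complete_graph (T : Type) : graph T :=
  @Graph T [set: T] (pairs [set: T]) (@subset_refl _ _).

Definition neighbours (T : Type) (G : graph T) (v : T) : set T :=
  [set w | vertices G w /\ edges G [set v; w]].

Definition cofinal (T : Type) (R : rel T) (A B : set T) : Prop :=
  A `<=` B /\ forall b, B b -> exists2 a, A a & R b a.

Definition is_path (T : Type) (G : graph T) : Prop :=
  exists R : rel T, {in <= vertices G, well_order R} /\
    forall v, vertices G v ->
      cofinal R [set w | neighbours G v w /\ strict R w v]
                [set w | vertices G w /\ strict R w v].

Section Coloring.
Variables (T C : Type) (c : edges (complete_graph T) -> C).

Definition color_graph (i : C) (X : set T) : graph T :=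
  @Graph T X (pairs X `&` [set val e | e in c @^-1` [set i]])
    (@subIsetl _ _ _).

Definition path_in_color (i : C) (X : set T) : Prop :=
  is_path (color_graph i X).

End Coloring.

Lemma omega1_order_exists : exists (W : Type) (R : rel W), omega1_order R.
Proof.
have [R woR] := well_ordering_principle (set nat).
have Runiq x y : R x y -> R y x -> x = y.
  move=> xy yx; have woT : wo_chain R predT by move=> A _; apply: woR.
  by apply: (wo_chain_antisymmetric woT); rewrite ?inE // xy.
have unc : ~ countable [set: set nat].
  move=> /countable_injP[f finj].
  pose D : set nat := [set n | exists2 A : set nat, f A = n & ~ A n].
  have fD : D (f D) <-> ~ D (f D).
    split=> [[A fA nA]|nD]; last by exists D.
    by have AD : A = D := finj _ _ (mem_set I) (mem_set I) fA; rewrite -{1}AD.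
  have nD : ~ D (f D) by move=> dD; apply: (fD.1 dD).
  by apply: (nD); apply/fD.
have [[x0 x0P]|small] := pselect (exists x, ~ countable [set y | strict R y x]);
    last first.
  exists (set nat), R; split=> // x; apply: contrapT => nx; apply: small.
  by exists x.
have /woR[m [[mP mmin] _]] :
    wochoice.nonempty [pred x | `[< ~ countable [set y | strict R y x] >]].
  by exists x0; rewrite inE.
move: mP; rewrite inE => mP.
pose S : set (set nat) := [set y | strict R y m].
exists S, (fun a b => R (val a) (val b)); split.
- move=> A [a Aa].
  have /woR[b [[bA bmin] _]] : wochoice.nonempty
      [pred x : set nat | `[< exists2 a : S, a \in A & val a = x >]].
    by exists (val a); rewrite inE; exists a.
  move: bA; rewrite inE => -[b' Ab' bE]; exists b'; split.
    split=> // z Az; rewrite bE; apply: bmin; rewrite inE.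
    by exists z.
  move=> z [Az zmin]; apply: val_inj; apply: Runiq; last exact: zmin.
  by rewrite bE; apply: bmin; rewrite inE; exists z.
- move=> /countable_injP[f finj]; apply: mP; apply/countable_injP.
  exists (fun y => if pselect (y \in S) is left yS then f (exist _ y yS) else 0).
  move=> y z yS zS; case: pselect => // yS'; case: pselect => // zS' /finj.
  by rewrite !inE => /(_ I I) [].
- move=> x; have xm : strict R (val x) m by have := valP x; rewrite inE.
  have /countable_injP[f finj] : countable [set y | strict R y (val x)].
    apply: contrapT => nx; have mx : R m (val x).
      by apply: mmin; rewrite inE.
    by case: xm => xm; apply; apply: Runiq.
  apply/countable_injP; exists (fun y => f (val y)) => y z.
  rewrite !inE => -[yx nyx] [zx nzx] /finj; rewrite !inE => yz.
  by apply/val_inj/yz; split=> // /val_inj.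
Qed.

(* Main.v *)
Require Import Defs.
From mathcomp Require Import all_boot.
From mathcomp Require Import boolp wochoice classical_sets functions cardinality.
From mathcomp Require Import filter.

(* The order-theoretic core is the partition of [W] into countable blocks
   [[d, d+)], where [d] runs over the closure points of a suitable function [h],
   so that a path of length omega_1 is assembled from countable ones.  Suppose
   that [W] is split into two classes such that (1) any two points of class [i]
   are joined by color-[i] paths with inner points arbitrarily far out, and (2)
   there is an uncountable set [E] such that, for every [b], each late enough
   point of [E] has an [i]-neighbour beyond [b] in class [i] and outside [E].
   Inside a
   block, finitely extending two disjoint paths in turn as in Rado's theorem
   yields two omega-paths covering the block, starting at prescribed points of
   [E]; by (2) these starting points are joined cofinally to all earlier blocks,
   so the concatenation of the blocks is a path in each color.

   To find such classes, take a uniform ultrafilter [U] and put [x] in class [i]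
   if [U]-many points are joined to [x] in color [i]; then (1) holds.  If (2)
   fails for uncountable classes, some uncountable [B] is joined in a single
   color [j] to uncountably many points [x], up to countably many exceptions for
   each [x]; choosing
   [U] with [B] in [U], either (2) holds with [E = B], or a second failure
   makes a final segment of [W] satisfy (1) and (2) for [j] alone.  In that case,
   as when one class is countable, the countably many remaining points either
   have uncountable degree in color [j] and join the [j]-path, or are joined to
   almost all points in the other color and lie on a countable path. *)

Set Implicit Arguments.
Unset Strict Implicit.

Local Open Scope classical_set_scope.

(** * Disjoint paths covering a countable set by finite extension *)

Section CountableCover.
Variables (W : eqType) (J : finType) (adj : J -> rel W) (lab : W -> J).
Variables (X : set W) (T : J -> set W).
Hypothesis TX : forall i x, T i x -> X x.
Hypothesis labT : forall x, X x -> T (lab x) x.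
Hypothesis linked : forall a b (F : seq W), X a -> X b -> lab a = lab b ->
  a <> b -> exists p, [/\ path (adj (lab a)) a (rcons p b),
    forall x, x \in p -> T (lab a) x & forall x, x \in p -> x \notin F].

(** By [linked], a path can be continued only from a vertex carrying the label of its color, hence
    the condition on last vertices; all other vertices need only lie in [T i]. *)
Definition path_system (s : J -> seq W) :=
  [/\ forall i, sorted (adj i) (s i),
      forall i, uniq (s i),
      forall i x, x \in s i -> T i x,
      forall i j x, x \in s i -> x \in s j -> i = j
    & forall i t x, s i = rcons t x -> lab x = i].

(** A new vertex [x] goes to the end of the path of color [lab x], through a link that avoids the
    finitely many vertices in use. *)
Lemma extend_path_system (s : J -> seq W) x : path_system s -> X x ->
  exists s', [/\ path_system s', forall i, prefix (s i) (s' i)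
               & exists i, x \in s' i].
Proof.
move=> gs Xx; have [srt unq sT dis lst] := gs.
have [[i xi]|nx] := pselect (exists i, x \in s i).
  by exists s; split=> // [j|]; [apply: prefix_refl|exists i].
pose F := flatten [seq s j | j <- enum J].
have inF j y : y \in s j -> y \in F.
  by move=> yj; apply/flattenP; exists (s j) => //; apply/map_f; rewrite mem_enum.
set i := lab x.
have [p [psrt punq pT [pF [q pE]]]] : exists p, [/\ sorted (adj i) (s i ++ p),
    uniq (s i ++ p), forall y, y \in p -> T i y
    & (forall j y, y \in p -> y \notin s j) /\ exists q, p = rcons q x].
  case/lastP E : (s i) => [|t a].
    exists [:: x]; split=> // [y|]; first by rewrite inE => /eqP->; apply: labT.
    split=> [j y|]; last by exists [::].
    by rewrite inE => /eqP->; apply/negP => xj; apply: nx; exists j.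
  have ai : a \in s i by rewrite E mem_rcons mem_head.
  have Xa := TX (sT _ _ ai); have la := lst _ _ _ E.
  have ax : a <> x by move=> ax; apply: nx; exists i; rewrite -ax.
  have [p []] := linked F Xa Xx la ax; rewrite la => pth pT pF.
  (* The link may repeat vertices; it is cut down to a simple path with the same end. *)
  case/shortenP: pth (last_rcons a p x) => p' pth' unq' sub' lstE.
  have p'x y : y \in p' -> y \in p \/ y = x.
    by move/sub'; rewrite mem_rcons inE => /orP[/eqP|]; auto.
  have p'F j y : y \in p' -> y \notin s j.
    move=> /p'x[/pF|->]; first by apply: contraNN; apply: inF.
    by apply/negP => xj; apply: nx; exists j.
  exists p'; split.
  - have := srt i; rewrite E; case: (t) => [|b u] //=.
    by rewrite cat_path last_rcons => ->.
  - rewrite -E cat_uniq unq; move: unq'; rewrite cons_uniq => /andP[_ ->].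
    by rewrite andbT; apply/hasPn => y /(p'F i).
  - by move=> y /p'x[/pT|->] //; apply: labT.
  split=> //; case/lastP: (p') lstE => [|u z]; rewrite ?last_rcons //=.
  by move=> ->; exists u.
exists (fun j => if j == i then s i ++ p else s j); split; first split.
- by move=> j /=; case: eqP => [->|_].
- by move=> j /=; case: eqP => [_|_].
- move=> j y /=; case: eqP => [->|_]; last exact: sT.
  by rewrite mem_cat => /orP[/sT|/pT].
- move=> j k y /=; case: eqP => [->|ji]; case: eqP => [->|ki] //; last exact: dis.
    by rewrite mem_cat => /orP[yi yk|/(pF k)/negP yp //]; apply: dis yi yk.
  by move=> yj; rewrite mem_cat => /orP[/(dis _ _ _ yj)|/(pF j)] //; rewrite yj.
- move=> j t y /=; case: eqP => [->|_]; last exact: lst.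
  by rewrite pE -rcons_cat => /rcons_inj[_ <-].
- by move=> j /=; case: eqP => [->|_]; [apply: prefix_prefix|apply: prefix_refl].
- by exists i; rewrite eqxx pE mem_cat mem_rcons mem_head orbT.
Qed.


(** The stages extend each other as prefixes, so class and position of a vertex are settled once it
    appears. The last clause comes from the last vertex of a stage. *)
Lemma countable_cover (e : nat -> W) (s0 : J -> seq W) :
  (forall x, X x -> exists n, e n = x) -> path_system s0 ->
  exists (P : W -> J) (pos : W -> nat), forall x, X x ->
    [/\ T (P x) x,
        forall y, X y -> P x = P y -> pos x = pos y -> x = y,
        forall k, pos x = k.+1 ->
          exists w, [/\ X w, P w = P x, pos w = k & adj (P x) w x],
        forall y, pos x = 0 -> ohead (s0 (P x)) = Some y -> x = y
      & exists2 y, X y & lab y = P x].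
Proof.
move=> eX gs0.
have /choice[F FP] : forall sn : (J -> seq W) * nat, exists s', path_system sn.1 ->
    [/\ path_system s', forall i, prefix (sn.1 i) (s' i)
      & X (e sn.2) -> exists i, e sn.2 \in s' i].
  move=> [s n] /=; have [gs|] := pselect (path_system s); last by exists s.
  have [Xe|nX] := pselect (X (e n)).
    by have [s' [? ? ?]] := extend_path_system gs Xe; exists s'; split.
  by exists s => _; split=> // i; apply: prefix_refl.
(* Stage [n] covers those of the first [n] values of [e] that lie in [X]. *)
pose st := fix st n := if n is m.+1 then F (st m, m) else s0.
have gst n : path_system (st n).
  by elim: n => //= n IHn; have [] := FP (st n, n) IHn.
have pre i n m : n <= m -> prefix (st n i) (st m i).
  move=> /subnK <-; elim: (m - n) => [|k IHk]; first exact: prefix_refl.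
  apply: prefix_trans IHk _; rewrite addSn /=.
  by have [_ /(_ i)] := FP (st (k + n), k + n) (gst _).
have idx i n m x : n <= m -> x \in st n i ->
    x \in st m i /\ index x (st m i) = index x (st n i).
  move=> /(pre i)/prefixP[t ->] xn; rewrite mem_cat xn; split=> //.
  by rewrite index_cat xn.
have cov x : exists Pn : J * nat, X x -> x \in st Pn.2 Pn.1.
  have [Xx|] := pselect (X x); last by exists (lab x, 0).
  have [n en] := eX _ Xx.
  have [_ _ /(_ _)[]] := FP (st n, n) (gst n); rewrite /= en // => i xi.
  by exists (i, n.+1).
have {cov}/choice[PN PNP] := cov.
pose P x := (PN x).1; pose pos x := index x (st (PN x).2 (P x)).
have PE x i n : X x -> x \in st n i -> P x = i /\ pos x = index x (st n i).
  move=> /PNP xP xi; have [xP' iP] := idx _ _ _ _ (leq_maxl (PN x).2 n) xP.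
  have [xi' ii] := idx _ _ _ _ (leq_maxr (PN x).2 n) xi.
  have [_ _ _ /(_ _ _ _ xP' xi')E _] := gst (maxn (PN x).2 n).
  by split; rewrite /pos /P // -iP -ii E.
exists P, pos => x Xx; have xP := PNP x Xx; rewrite -/(P x) in xP.
set n := (PN x).2 in xP; have [srt unq sT dis lst] := gst n; split.
- exact: sT xP.
- move=> y Xy Pxy; have yP := PNP y Xy; rewrite -/(P y) -Pxy in yP.
  have [xm xE] := idx _ _ _ _ (leq_maxl n (PN y).2) xP.
  have [ym yE] := idx _ _ _ _ (leq_maxr n (PN y).2) yP.
  have [_ ->] := PE _ _ _ Xx xm; have [_ ->] := PE _ _ _ Xy ym.
  by apply: index_inj.
- move=> k; rewrite /pos -/n => xk.
  have ks : k.+1 < size (st n (P x)) by rewrite -xk index_mem.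
  have wP : nth x (st n (P x)) k \in st n (P x) by apply/mem_nth/ltnW.
  have Xw := TX (sT _ _ wP); have [Pw pw] := PE _ _ _ Xw wP.
  exists (nth x (st n (P x)) k); split=> //.
    by rewrite [LHS]pw index_uniq // ltnW.
  have /sortedP-/(_ x k ks) := srt (P x).
  by rewrite -xk nth_index.
- move=> y x0; rewrite /pos -/n in x0.
  have /prefixP[t E] := pre (P x) _ _ (leq0n n).
  move: x0; rewrite E /=; case: (s0 (P x)) => //= z u.
  by case: eqP => // -> _ [].
- move: xP; case/lastP E : (st n (P x)) => [|t y] // _.
  exists y; last exact: lst E.
  by apply: (TX (i := P x)); apply: sT; rewrite E mem_rcons mem_head.
Qed.

End CountableCover.

(** * Order and boundedness in omega_1 *)

Section Omega1.
Variables (W : eqType) (R : rel W).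
Hypothesis om1 : omega1_order R.

Local Notation "x ≼ y" := (is_true (R x y)) (at level 70, no associativity).
Local Notation "x ≺ y" := (is_true (~~ R y x)) (at level 70, no associativity).

Let woW : wo_chain R predT.
Proof. by move=> A _; have [wo _ _] := om1; apply: wo. Qed.

Lemma le_total x y : x ≼ y \/ y ≼ x.
Proof. by apply/orP; exact: (wo_chainW woW). Qed.

Lemma le_refl x : x ≼ x.
Proof. exact: (wo_chain_reflexive woW). Qed.

Lemma le_anti x y : x ≼ y -> y ≼ x -> x = y.
Proof. by move=> xy yx; apply: (wo_chain_antisymmetric woW); rewrite ?xy. Qed.

Lemma exists_min (A : set W) :
  (exists x, A x) -> exists2 m, A m & forall x, A x -> m ≼ x.
Proof.
move=> [x Ax]; have [wo _ _] := om1.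
have /wo[m [[mA mmin] _]] : wochoice.nonempty [pred x | `[< A x >]].
  by exists x; rewrite inE.
exists m => [|y Ay]; first by move: mA; rewrite inE.
by apply: mmin; rewrite inE.
Qed.

(** Read off the least element of {x, y, z}. *)
Lemma le_trans y x z : x ≼ y -> y ≼ z -> x ≼ z.
Proof.
move=> xy yz; have [|m mE mmin] := @exists_min [set t | t \in [:: x; y; z]].
  by exists x; rewrite /= !inE eqxx.
have [mx my mz] : [/\ m ≼ x, m ≼ y & m ≼ z].
  by split; apply: mmin; rewrite /= !inE eqxx ?orbT.
move: mE; rewrite /= !inE => /or3P[] /eqP mE; rewrite mE in mx my mz => //.
  by rewrite (le_anti xy mx).
by rewrite -(le_anti yz my).
Qed.

Lemma ltW x y : x ≺ y -> x ≼ y.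
Proof. by case: (le_total x y) => // ->. Qed.

Lemma le_lt_trans y x z : x ≼ y -> y ≺ z -> x ≺ z.
Proof. by move=> xy; apply: contraNN => zx; apply: le_trans zx xy. Qed.

Lemma lt_le_trans y x z : x ≺ y -> y ≼ z -> x ≺ z.
Proof. by move=> + yz; apply: contraNN => zx; apply: le_trans yz zx. Qed.

Lemma le_eqVlt x y : x ≼ y -> x = y \/ x ≺ y.
Proof. by move=> xy; case: (boolP (R y x)) => [/(le_anti xy)|]; [left|right]. Qed.

(** Otherwise [W] is the union of the countable initial segments up to the [f n], hence
    countable. *)
Lemma seq_bounded (f : nat -> W) : exists b, forall n, f n ≺ b.
Proof.
have [_ unc cs] := om1; apply: contrapT => nb; apply: unc.
have -> : [set: W] = \bigcup_(n in setT) \bigcup_(c in [set: bool])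
    (if c then [set y | strict R y (f n)] else [set f n]).
  apply/seteqP; split=> // x _; apply: contrapT => nx; apply: nb; exists x => n.
  apply/negP => xfn; apply: nx; exists n => //.
  have [->|xf] := eqVneq x (f n); first by exists false.
  by exists true => //; split=> //; apply/eqP.
apply: bigcup_countable => // n _; apply: bigcup_countable => // -[] _ //.
Qed.

Lemma enum_below b : exists e : nat -> W, forall x, x ≼ b -> exists n, e n = x.
Proof.
have [_ _ /(_ b) /countable_injP[f finj]] := om1.
exists (fun n => if n is n'.+1 then
    if pselect (exists2 x, strict R x b & f x = n') is left ex then s2val (cid2 ex)
    else b else b) => x xb.
have [->|xnb] := eqVneq x b; first by exists 0.
have sx : strict R x b by split=> //; apply/eqP.
exists (f x).+1; case: pselect => [ex|[]]; last by exists x.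
by case: (cid2 ex) => y /= sy /finj; apply; rewrite inE.
Qed.

(** In omega_1 these are the sets with countable complement; a set is uncountable exactly when its
    complement is not [ev]. *)
Definition ev (P : set W) := exists b, forall x, b ≼ x -> P x.

Lemma ev_gt b : ev (fun x => b ≺ x).
Proof.
have [c bc] := seq_bounded (fun=> b); exists c => x cx.
exact: lt_le_trans (bc 0) cx.
Qed.

Lemma evS (P Q : set W) : P `<=` Q -> ev P -> ev Q.
Proof. by move=> PQ [b Pb]; exists b => x /Pb/PQ. Qed.

Lemma ev_all_nat (P : nat -> set W) :
  (forall n, ev (P n)) -> ev (fun x => forall n, P n x).
Proof.
move=> /choice[f Pf]; have [b fb] := seq_bounded f.
by exists b => x bx n; apply: Pf; apply: le_trans bx; apply: ltW.
Qed.

Lemma evI (P Q : set W) : ev P -> ev Q -> ev (fun x => P x /\ Q x).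
Proof.
move=> eP eQ; have := @ev_all_nat (fun n => if n is 0 then P else Q).
by move=> /(_ _)/evS; apply=> [x PQ|[]//]; split; [apply: (PQ 0)|apply: (PQ 1)].
Qed.

Lemma ev_all_le b (P : W -> set W) :
  (forall a, ev (P a)) -> ev (fun x => forall a, a ≼ b -> P a x).
Proof.
move=> eP; have [e eE] := enum_below b.
by apply: evS (ev_all_nat (fun n => eP (e n))) => x Px a /eE[n <-].
Qed.

Lemma ev_all_ord n (P : 'I_n.+1 -> set W) :
  (forall i, ev (P i)) -> ev (fun x => forall i, P i x).
Proof.
move=> eP; have := @ev_all_nat (fun k => P (inord k)) (fun k => eP _).
by apply: evS => x Px i; rewrite -(inord_val i).
Qed.

(** * Closure points and blocks *)

Definition closure_point (h : W -> W) (d : W) := forall b, b ≺ d -> h b ≺ d.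

(** The supremum of the iterates of [k] from [b]; as [h] need not be monotone, [k a] bounds [h] on
    the whole segment up to [a]. *)
Lemma closure_point_unbounded h b : exists2 d, closure_point h d & b ≺ d.
Proof.
have /choice[k kP] : forall a, exists c, forall x, x ≼ a -> h x ≺ c.
  move=> a; have [c cP] := @ev_all_le a _ (fun x => ev_gt (h x)).
  by exists c; apply: cP; apply: le_refl.
pose f n := iter n k b.
have [s fs smin] := @exists_min (fun s => forall n, f n ≺ s) (seq_bounded f).
exists s => [a|]; last exact: (fs 0).
apply: contraNN => sha; apply: smin => n; apply/negP => afn.
by have := lt_le_trans (kP _ _ afn) (ltW (fs n.+1)); rewrite sha.
Qed.

(** [base x] is the supremum of the closure points up to [x], itself a closure point. The blocks are
    the fibres of [base]. *)
Lemma exists_base h : exists base : W -> W,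
  [/\ forall x, closure_point h (base x), forall x, base x ≼ x
    & forall x d, closure_point h d -> base x ≺ d -> x ≺ d].
Proof.
have /choice[base baseP] : forall x, exists b,
    [/\ closure_point h b, b ≼ x & forall d, closure_point h d -> b ≺ d -> x ≺ d].
  move=> x; have [|s sx smin] := @exists_min
    (fun s => forall d, closure_point h d -> d ≼ x -> d ≼ s).
    by exists x.
  exists s; split=> [b|| d cd sd]; last 2 first.
  - exact: smin.
  - by apply: contraTN sd => dx; rewrite negbK; apply: sx.
  apply: contraNN => shb; apply: smin => d cd dx; apply/negP => /negP bd.
by have := lt_le_trans (cd _ bd) (sx _ cd dx); rewrite shb.
by exists base; split=> x *; have [] := baseP x; auto.
Qed.

Section Blocks.
Variables (h base : W -> W).
Hypothesis h_gt : forall x, x ≺ h x.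
Hypothesis base_closed : forall x, closure_point h (base x).
Hypothesis base_le : forall x, base x ≼ x.
Hypothesis base_max : forall x d, closure_point h d -> base x ≺ d -> x ≺ d.

Lemma base_lt x y : base x ≺ base y -> h x ≺ base y.
Proof. by move=> xy; apply: base_closed; apply: base_max. Qed.

Lemma base_mono x y : x ≼ y -> base x ≼ base y.
Proof.
move=> xy; apply/negP => /negP yx; have := base_max (@base_closed x) yx.
by rewrite (le_trans (base_le x) xy).
Qed.

Lemma base_h x : base (h x) = base x.
Proof.
apply: le_anti; last exact/base_mono/ltW.
by apply/negP => /negP /base_lt /negP[]; apply: base_le.
Qed.

Lemma base_convex b x y : b ≼ x -> x ≼ y -> base y = base b -> base x = base b.
Proof. by move=> /base_mono bx /base_mono + yb; rewrite yb => xb; apply: le_anti. Qed.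

Lemma base_id d : closure_point h d -> base d = d.
Proof.
move=> cd; apply: le_anti => //; apply/negP => /negP /(base_max cd).
by rewrite le_refl.
Qed.

Lemma base_interval b x : b ≼ x -> x ≺ h b -> base x = base b.
Proof. by move=> bx /ltW xb; apply: base_convex bx xb _; apply: base_h. Qed.

End Blocks.

(** [S] consists of the initial intervals [[d, h d)] of the blocks. The next interval
    [[h d, h (h d))] lies in the same block and misses [S]. *)
Lemma interval_splitting h : (forall x, x ≺ h x) -> exists S : set W,
  forall b, (exists2 b1, b ≼ b1 & forall x, b1 ≼ x -> x ≺ h b1 -> S x) /\
            (exists2 b2, b ≼ b2 & forall x, b2 ≼ x -> x ≺ h b2 -> ~ S x).
Proof.
move=> hgt; have [base [bc ble bmax]] := exists_base h.
exists (fun x => x ≺ h (base x)) => b.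
have [d cd bd] := closure_point_unbounded h b.
have bid := base_id ble bmax cd.
split.
  exists d; first exact: ltW.
  by move=> x dx xd; rewrite (base_interval hgt bc ble bmax dx xd) bid.
exists (h d) => [|x dx xd].
  by apply/ltW/(lt_le_trans bd)/ltW.
rewrite (base_interval hgt bc ble bmax dx xd).
by rewrite (base_h hgt bc ble bmax) bid dx.
Qed.

(** * Partition into paths from linked classes *)

(** The conclusion of the theorem for boolean adjacency, with the cofinality of earlier neighbours
    unfolded. *)
Definition partitionable (adj : 'I_2 -> rel W) :=
  exists P : W -> 'I_2, forall i, exists le : rel W,
    {in <= [set x | P x = i], well_order le} /\
    forall v b, P v = i -> P b = i -> strict le b v ->
      exists w, [/\ P w = i, strict le w v, adj i v w & le b w].

Section PathPartition.
Variables (adj : 'I_2 -> rel W) (lab : W -> 'I_2) (E : set W).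
Hypothesis adjC : forall i, symmetric (adj i).
Hypothesis unbE : ~ ev (~` E).
Hypothesis linked : forall b x y, lab x = lab y -> x <> y ->
  exists p, path (adj (lab x)) x (rcons p y) /\
    forall z, z \in p -> b ≺ z /\ (E z \/ lab z = lab x).

(** Only an uncountable class can supply neighbours beyond every point, so (2) is asked for such
    classes. *)
Let act i := ~ ev (fun x => lab x <> i).

Hypothesis concentrated : forall i, act i -> forall b,
  ev (fun g => forall y, E y -> g ≼ y ->
    exists x, [/\ lab x = i, ~ E x, b ≼ x, x ≺ g & adj i x y]).

(** What a block has to find inside itself: links between its points, a starting point in [E] for
    each color and neighbours of later points of [E]; moreover, bounded classes have ended before
    [g]. *)
Definition path_closure (b g : W) :=
  [/\ b ≺ g,
      forall x, x ≼ b -> forall y, y ≼ b -> lab x = lab y -> x <> y ->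
        exists p, path (adj (lab x)) x (rcons p y) /\
          forall z, z \in p -> [/\ b ≺ z, z ≺ g & E z \/ lab z = lab x],
      exists y : 'I_2 -> W, injective y /\ forall i, [/\ E (y i), b ≼ y i & y i ≺ g],
      forall i, act i -> forall y, E y -> g ≼ y ->
        exists x, [/\ lab x = i, ~ E x, b ≼ x, x ≺ g & adj i x y]
    & forall i, ~ act i -> forall x, g ≼ x -> lab x <> i].

Lemma unbounded_gt (A : set W) : ~ ev (~` A) -> forall b, exists2 x, A x & b ≺ x.
Proof.
move=> nA b; apply: contrapT => nx; apply: nA.
have [c cP] := ev_gt b; exists c => x cx Ax; apply: nx.
by exists x => //; apply: cP.
Qed.

Lemma ev_above_seq (b : W) (s : seq W) : ev (fun x => forall y, y \in s -> y ≺ x).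
Proof.
elim: s => [|y s IHs]; first by exists b.
apply: evS (evI (ev_gt y) IHs) => x [yx sx] z; rewrite inE => /orP[/eqP->|] //.
exact: sx.
Qed.

(** Each requirement holds for all late enough [g], since countably many such demands can be met at
    once. *)
Lemma exists_path_closure : exists h, forall b, path_closure b (h b).
Proof.
suff /choice[h hP] : forall b, exists g, path_closure b g by exists h.
move=> b.
have e1 := ev_gt b.
have e2 : ev (fun g => forall x, x ≼ b -> forall y, y ≼ b -> lab x = lab y -> x <> y ->
        exists p, path (adj (lab x)) x (rcons p y) /\
          forall z, z \in p -> [/\ b ≺ z, z ≺ g & E z \/ lab z = lab x]).
  apply: ev_all_le => x; apply: ev_all_le => y.
  have [[xy nxy]|nxy] := pselect (lab x = lab y /\ x <> y); last first.
    by exists x => g _ xy xny; case: nxy.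
  have [p [xp pP]] := linked b xy nxy.
  apply: evS (ev_above_seq b p) => g pg _ _; exists p; split=> // z zp.
  by have [bz Ez] := pP z zp; split=> //; apply: pg.
have e3 : ev (fun g => exists y : 'I_2 -> W,
    injective y /\ forall i, [/\ E (y i), b ≼ y i & y i ≺ g]).
  have [y0 Ey0 by0] := unbounded_gt unbE b.
  have [y1 Ey1 y01] := unbounded_gt unbE y0.
  apply: evS (ev_gt y1) => g y1g.
  have n01 : y0 != y1 by apply/eqP => E01; move: y01; rewrite E01 le_refl.
  exists (fun i => if i == ord0 then y0 else y1); split.
    move=> i j; have [->|i0] := eqVneq i ord0; have [->|j0] := eqVneq j ord0 => //.
    - by move/eqP; rewrite (negPf n01).
    - by move/esym/eqP; rewrite (negPf n01).
    by move=> _; apply/val_inj; case: i i0 => [[|[|]]] //; case: j j0 => [[|[|]]].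
  move=> i; case: eqP => _; split=> //.
  - exact: ltW.
  - exact: lt_le_trans y01 (ltW y1g).
  - exact/ltW/(lt_le_trans by0)/ltW.
have e4 : ev (fun g => forall i, act i -> forall y, E y -> g ≼ y ->
        exists x, [/\ lab x = i, ~ E x, b ≼ x, x ≺ g & adj i x y]).
  apply: ev_all_ord => i; have [ai|ni] := pselect (act i); last by exists b.
  by apply: evS (concentrated ai b) => g cg _.
have e5 : ev (fun g => forall i, ~ act i -> forall x, g ≼ x -> lab x <> i).
  apply: ev_all_ord => i; have [ai|ni] := pselect (act i); first by exists b.
  have [c cP] := contrapT ni; exists c => g cg _ x gx; apply: cP.
  exact: le_trans gx.
have [g gP] := evI e1 (evI e2 (evI e3 (evI e4 e5))).
by exists g; have [? [? [? []]]] := gP g (le_refl g); split.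
Qed.

Section Block.
Variables (h base : W -> W).
Hypothesis hP : forall b, path_closure b (h b).
Hypothesis base_closed : forall x, closure_point h (base x).
Hypothesis base_le : forall x, base x ≼ x.
Hypothesis base_max : forall x d, closure_point h d -> base x ≺ d -> x ≺ d.

Let h_gt x : x ≺ h x.
Proof. by have [] := hP x. Qed.

Let base_between b x : b ≼ x -> x ≺ h b -> base x = base b.
Proof. exact: (base_interval h_gt (@base_closed) base_le (@base_max)). Qed.

Lemma block_bound b0 (F : seq W) : exists b, [/\ base b = base b0, b0 ≼ b
  & forall x, x \in F -> base x = base b0 -> x ≼ b].
Proof.
elim: F => [|y F [b [bd b0b bF]]]; first by exists b0; split=> //; apply: le_refl.
have [yd|nyd] := eqVneq (base y) (base b0); last first.
  exists b; split=> // x; rewrite inE => /orP[/eqP->|/bF //] yd.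
  by rewrite yd eqxx in nyd.
have [yb|by_] := le_total y b.
  by exists b; split=> // x; rewrite inE => /orP[/eqP->|/bF].
exists y; split=> // [|x]; first exact: le_trans by_.
rewrite inE => /orP[/eqP->|xF xd]; first by rewrite le_refl.
exact: le_trans (bF _ xF xd) by_.
Qed.

Lemma block_cover d : closure_point h d ->
  exists (P : W -> 'I_2) (pos : W -> nat), forall x, base x = d ->
  [/\ E x \/ lab x = P x,
      forall y, base y = d -> P x = P y -> pos x = pos y -> x = y,
      forall k, pos x = k.+1 ->
        exists w, [/\ base w = d, P w = P x, pos w = k & adj (P x) w x],
      pos x = 0 -> act (P x) -> E x
    & exists2 y, base y = d & lab y = P x].
Proof.
move=> cd; have bd : base d = d := base_id base_le (@base_max) cd.
(* The block of [d] lies below the later closure point [d'], so [e] enumerates it. *)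
have [d' cd' dd'] := closure_point_unbounded h d.
have [e eP] := enum_below d'.
have [_ _ [y [yinj yP]] _ _] := hP (h d).
have /choice[x xP] : forall i, exists x, act i ->
    [/\ lab x = i, ~ E x, d ≼ x, x ≺ h d & adj i x (y i)].
  move=> i; have [ai|] := pselect (act i); last by exists d.
  have [_ _ _ /(_ i ai (y i)) + _] := hP d; have [Ey hdy _] := yP i.
  by move=> /(_ Ey hdy)[x xP]; exists x.
have bx i : act i -> base (x i) = d.
  by move=> /xP[_ _ dx xh _]; rewrite (base_between dx xh).
have by_ i : base (y i) = d.
  by have [_ hy yh] := yP i; rewrite (base_between hy yh)
     (base_h h_gt (@base_closed) base_le (@base_max)) bd.
(* [y i] puts a point of [E] first; [x i] follows because a path must end in a vertex labelled [i]
   to be continued. *)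
pose s0 i := if `[< act i >] then [:: y i; x i] else [::].
have s0P i z : z \in s0 i -> act i /\ (z = y i \/ z = x i).
  rewrite /s0; case: asboolP => // ai; rewrite !inE.
  by move=> /orP[]/eqP->; auto.
have s0S : path_system adj lab (fun i z => base z = d /\ (E z \/ lab z = i)) s0.
  split=> [i|i|i z /s0P[ai]|i j z|i t z]; rewrite /s0.
  - by case: asboolP => //= /xP[_ _ _ _]; rewrite adjC => ->.
  - case: asboolP => //= /xP[_ nEx _ _ _]; rewrite inE andbT.
    by apply/eqP => yx; apply: nEx; rewrite -yx; have [] := yP i.
  - have [Ey _ _] := yP i; have [lx _ _ _ _] := xP i ai.
    by case=> ->; split; auto.
  - move=> /s0P[ai zi] /s0P[aj zj]; have [li nEi _ _ _] := xP i ai.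
    have [lj nEj _ _ _] := xP j aj; have [Eyi _ _] := yP i; have [Eyj _ _] := yP j.
    case: zi zj => -> [] zE.
    + exact: yinj.
    + by rewrite -zE in nEj.
    + by rewrite zE in nEi.
    + by rewrite -lj -zE li.
  - case: asboolP => // [/xP[li _ _ _ _]|_]; last by case: t.
    by case: t => [|a [|b [|c t]]] //= [_ <-].
have Xlink a b (F : seq W) : base a = d -> base b = d -> lab a = lab b -> a <> b ->
    exists p, [/\ path (adj (lab a)) a (rcons p b),
      forall z, z \in p -> base z = d /\ (E z \/ lab z = lab a)
    & forall z, z \in p -> z \notin F].
  (* With [c] in the block and not below any point of [F] there, inner vertices between [c] and
     [h c] avoid [F]. *)
  move=> ad bd' lab_ nab; have [c [cd0 ac cF]] := block_bound a (b :: F).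
  have bc : b ≼ c by apply: cF; rewrite ?mem_head // ad.
  have [_ /(_ a ac b bc lab_ nab)[p [ab pP]] _ _ _] := hP c.
  exists p; split=> // z /pP[cz zh Ez].
    by split=> //; rewrite (base_between (ltW cz) zh) cd0.
  apply: contraTN (cz) => zF; rewrite negbK; apply: cF.
    by rewrite inE zF orbT.
  by rewrite (base_between (ltW cz) zh).
have [|||P [pos PP]] := countable_cover (e := e) _ _ Xlink _ s0S.
- by move=> i z [].
- by move=> z zd; split; auto.
- move=> z zd; apply/eP/ltW/base_max => //.
  by rewrite zd.
exists P, pos => z zd; have [[_ Ez] inj prd hd nE] := PP z zd; split=> //.
move=> z0 az; have /hd -> // : ohead (s0 (P z)) = Some (y (P z)).
  by rewrite /s0 asboolT.
by have [] := yP (P z).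
Qed.

End Block.

(* Each class is ordered lexicographically, first by block and then by position
   in the block.  The first vertex [v] of a class in a block lies in [E], hence
   has unboundedly many neighbours in each earlier block; these all lie in the
   class of [v], and only finitely many of them precede a given vertex. *)
Lemma path_partition : partitionable adj.
Proof.
have [h hP] := exists_path_closure; have hgt x : x ≺ h x by have [] := hP x.
have [base [bc ble bmax]] := exists_base h.
have bb b x : b ≼ x -> x ≺ h b -> base x = base b.
  exact: (base_interval hgt bc ble bmax).
have /choice[Q QP] : forall d, exists Q : (W -> 'I_2) * (W -> nat),
    closure_point h d -> forall x, base x = d ->
    [/\ E x \/ lab x = Q.1 x,
      forall y, base y = d -> Q.1 x = Q.1 y -> Q.2 x = Q.2 y -> x = y,
      forall k, Q.2 x = k.+1 ->
        exists w, [/\ base w = d, Q.1 w = Q.1 x, Q.2 w = k & adj (Q.1 x) w x],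
      Q.2 x = 0 -> act (Q.1 x) -> E x
    & exists2 y, base y = d & lab y = Q.1 x].
  move=> d; have [cd|ncd] := pselect (closure_point h d).
    by have [P [pos PP]] := block_cover hP bc ble bmax cd; exists (P, pos).
  by exists (lab, fun=> 0).
pose P x := (Q (base x)).1 x; pose pos x := (Q (base x)).2 x.
have PP x : [/\ E x \/ lab x = P x,
      forall y, base y = base x -> P x = P y -> pos x = pos y -> x = y,
      forall k, pos x = k.+1 ->
        exists w, [/\ base w = base x, P w = P x, pos w = k & adj (P x) w x],
      pos x = 0 -> act (P x) -> E x
    & exists2 y, base y = base x & lab y = P x].
  have [Ex inj prd hd nE] := QP _ (bc x) x erefl; split=> //.
    by move=> y yx; rewrite /P /pos yx; apply: inj.
  move=> k /prd[w [wx Pw pw aw]]; exists w; split=> //.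
    by rewrite /P wx.
  by rewrite /pos wx.
exists P => i.
pose le x y := if base x == base y then pos x <= pos y else R (base x) (base y).
have le_base x y : le x y -> base x ≼ base y.
  by rewrite /le; case: eqP => // -> _; apply: le_refl.
have lt_base x y : base x ≺ base y -> le x y.
  by rewrite /le; case: eqP => [->|_ /ltW //]; rewrite le_refl.
exists le; split.
  apply: antisymmetric_wo_chain.
    move=> x y; rewrite !inE /= => Px Py /andP[xy yx].
    have bE := le_anti (le_base _ _ xy) (le_base _ _ yx).
    have [_ inj _ _ _] := PP x; apply: inj => //; first by rewrite Py.
    by move: xy yx; rewrite /le bE eqxx => xy yx; apply/eqP; rewrite eqn_leq xy.
  move=> A _ [x0 Ax0].
  have [|d [x1 Ax1 dE] dmin] := @exists_min [set d | exists2 x, x \in A & base x = d].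
    by exists (base x0), x0.
  have ex : exists n, `[< exists x, [/\ x \in A, base x = d & pos x = n] >].
    by exists (pos x1); apply/asboolP; exists x1.
  case: (ex_minnP ex) => n /asboolP[x [Ax xd xn]] nmin; exists x; split=> // y Ay.
  rewrite /le; case: eqP => [xy|_]; last by rewrite xd; apply: dmin; exists y.
  by rewrite xn; apply: nmin; apply/asboolP; exists y; split=> //; rewrite -xy.
move=> v b Pv Pb [bv nbv].
have [_ _ prd hd [z zv zP]] := PP v; rewrite Pv in prd hd zP.
case pv : (pos v) prd hd => [|k] prd hd; last first.
  have [w [wv Pw pw wav]] := prd k erefl; exists w; split=> //; last 2 first.
  - by rewrite adjC.
  - move: bv; rewrite /le wv pv pw; case: eqP => [bv bk|//].
    rewrite -ltnS ltn_neqAle bk andbT; apply/eqP => bk'; apply: nbv.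
    have [_ inj _ _ _] := PP b; apply: inj => //; first by rewrite Pv.
    by rewrite bk' pv.
  - split; first by rewrite /le wv eqxx pw pv.
    by move=> wv'; move: pw; rewrite wv' pv => /esym/n_Sn.
have bltv : base b ≺ base v.
  have [bEv|] := le_eqVlt (le_base _ _ bv); last by [].
  case: nbv; have [_ inj _ _ _] := PP b; apply: inj => //; first by rewrite Pv.
  by move: bv; rewrite /le bEv eqxx pv leqn0 => /eqP.
have hlt c : base c = base b -> h c ≺ base v.
  by move=> cb; apply: (base_lt bc bmax); rewrite cb.
(* [z] carries the label [i] beyond [h b], where a bounded class has no points left. *)
have ai : act i.
  apply: contrapT => ni; have [_ _ _ _ /(_ i ni z)] := hP b; apply=> //.
  by apply/ltW/(lt_le_trans (hlt b erefl)); rewrite -zv.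
have Ev := hd erefl ai.
have [c cb cP] : exists2 c, base c = base b & forall x, base x = base b ->
    P x = i -> c ≼ x -> pos b <= pos x.
  elim: (pos b) => [|n [c cb cP]]; first by exists b.
  (* Positions are injective, so at most one vertex [x] of the class sits at position [n]; the bound
     is moved past it, to [h x] or further. *)
  have [[x [xb Px xn]]|nx] := pselect (exists x, [/\ base x = base b, P x = i & pos x = n]).
    have [c' [c'b cc' c'x]] := block_bound base c [:: h x].
    exists c'; first by rewrite c'b.
    move=> y yb Py c'y; rewrite ltn_neqAle cP ?andbT //; last exact: le_trans c'y.
    apply/eqP => ny; have [_ inj _ _ _] := PP x.
    have xy : x = y by apply: inj; rewrite ?yb ?xb ?Py ?xn.
    have := hgt x; rewrite xy (le_trans _ c'y) // -xy; apply: c'x; rewrite ?mem_head //.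
    by rewrite (base_h hgt bc ble bmax) xb cb.
  exists c => // y yb Py cy; rewrite ltn_neqAle cP ?andbT //.
  by apply/eqP => ny; apply: nx; exists y.
have [_ _ _ /(_ i ai v Ev) + _] := hP c.
case=> [|x [lx nEx cx xh xav]].
  by apply/ltW/(lt_le_trans (hlt c cb)).
have xb : base x = base b by rewrite (bb _ _ cx xh).
(* Outside [E] the class in the partition is the label; this is why witnesses must avoid [E]. *)
have Px : P x = i by have [[//|<-]] := PP x.
exists x; split=> //; last 2 first.
- by rewrite adjC.
- by rewrite /le xb eqxx; apply: cP.
split; first by apply: lt_base; rewrite xb.
by move=> xv; apply: nEx; rewrite xv.
Qed.

End PathPartition.

(** Extends the filter of sets containing a final part of [B], proper because [B] is unbounded. *)
Lemma uniform_ultrafilter (B : set W) : ~ ev (~` B) ->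
  exists U : set_system W, [/\ UltraFilter U, forall A, ev A -> U A & U B].
Proof.
move=> unbB; pose F : set_system W := fun A => ev (fun x => B x -> A x).
have [b] : exists b : W, setT b.
  apply: contrapT => nW; have [_ unc _] := om1; apply: unc.
  suff -> : [set: W] = set0 by exact: countable0.
  by apply/seteqP; split=> // x _; case: nW; exists x.
move=> _.
have FF : ProperFilter F.
  apply: Build_ProperFilter_ex.
    move=> A FA; apply: contrapT => nA; apply: unbB; apply: evS FA => x BA Bx.
    by apply: nA; exists x; apply: BA.
  split; first by exists b.
    by move=> A C FA FC; apply: evS (evI FA FC) => x [BA BC] Bx; split; auto.
  by move=> A C AC; apply: evS => x BA /BA/AC.
have [U [UU FU]] := ultraFilterLemma FF.
exists U; split=> // [A eA|]; apply: FU; last by exists b.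
by apply: evS eA => x Ax _.
Qed.

(** * Condition (2) for a coloring, and its failure *)

Section Coloring.
Variables adj : 'I_2 -> rel W.
Hypothesis adjC : forall i, symmetric (adj i).
Hypothesis adj_total : forall i x y, x <> y -> ~~ adj i x y -> adj (rev_ord i) x y.
Hypothesis adj_inj : forall i j x y, adj i x y -> adj j x y -> i = j.

Let color_case (i k : 'I_2) : k = i \/ k = rev_ord i.
Proof.
by case: i k => [[|[|?]] ?] [[|[|?]] ?] //; [left|right|right|left]; apply/val_inj.
Qed.

Let rev_neq (i : 'I_2) : rev_ord i <> i.
Proof. by case: i => [[|[|?]] ?] // []. Qed.

(** Condition (2) with neighbours from [A]; avoiding [E] is arranged later by [concentrated_split].
    The bound [g] is uniform in [y]. *)
Definition concentrated_in (A E : set W) i := forall b,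
  ev (fun g => forall y, E y -> g ≼ y ->
    exists x, [/\ A x, b ≼ x, x ≺ g & adj i x y]).

Definition almost_joined (B : set W) i x := ev (fun y => B y -> adj i x y).

Lemma concentratedS (A A' E : set W) i :
  A `<=` A' -> concentrated_in A E i -> concentrated_in A' E i.
Proof.
move=> AA' cA b; apply: evS (cA b) => g gP y Ey /(gP y Ey)[x [/AA' ? ? ? ?]].
by exists x.
Qed.

Lemma concentrated_ge c (A E : set W) i : concentrated_in A E i ->
  concentrated_in [set x | A x /\ c ≼ x] E i.
Proof.
move=> cA b; have [d dP] := evI (ev_gt b) (ev_gt c).
have [/ltW bd /ltW cd] := dP d (le_refl d).
apply: evS (cA d) => g gP y Ey /(gP y Ey)[x [Ax dx xg xy]].
by exists x; split=> //; [split=> //; apply: le_trans dx|apply: le_trans dx].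
Qed.

(** A single [x] of [A] beyond [b] is a neighbour of all late points of [B]. *)
Lemma almost_joined_concentrated (A B : set W) i : ~ ev (~` A) ->
  (forall x, A x -> almost_joined B i x) -> concentrated_in A B i.
Proof.
move=> unbA AB b; have [x Ax bx] := unbounded_gt unbA b.
have [c cP] := AB x Ax; apply: evS (evI (ev_gt x) (ev_gt c)) => g [xg cg] y By gy.
exists x; split=> //; first exact: ltW.
by apply: cP => //; apply: le_trans gy; apply: ltW.
Qed.

(** Failure at [b] gives, arbitrarily far out, pairs [g], [y] such that [y] has no [i]-neighbour in
    [A] between [b] and [g]; these [y] form [B]. *)
Lemma not_concentrated (A E : set W) i : ~ concentrated_in A E i ->
  exists B b, [/\ B `<=` E, ~ ev (~` B) &
    forall x, A x -> b ≼ x -> almost_joined B (rev_ord i) x].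
Proof.
move=> /existsNP[b nb].
have /choice[f fP] : forall c, exists gy : W * W, [/\ c ≼ gy.1, gy.1 ≼ gy.2, E gy.2
    & forall x, A x -> b ≼ x -> x ≺ gy.1 -> ~~ adj i x gy.2].
  move=> c; apply: contrapT => nc; apply: nb; exists c => g cg y Ey gy.
  apply: contrapT => nx; apply: nc; exists (g, y); split=> // x Ax bx xg.
  by apply/negP => xy; apply: nx; exists x.
exists (range (fun c => (f c).2)), b; split.
- by move=> _ [c _ <-]; have [] := fP c.
- move=> [c cP]; apply: (cP (f c).2); last by exists c.
  by have [c1 c2 _ _] := fP c; apply: le_trans c2.
- move=> x Ax bx.
  (* Exceptions for [x] arise only from [c] up to [x], and [d] is beyond all points these
     produce. *)
  have [d dP] := @ev_all_le x _ (fun c => ev_gt (f c).2).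
  exists d => y dy [c _ fc].
  have xc : x ≺ c by apply/negP => cx; have := dP y dy c cx; rewrite fc le_refl.
  rewrite -fc.
  have [c1 c2 _ /(_ x Ax bx)nadj] := fP c; have xf := lt_le_trans xc c1.
  apply: adj_total (nadj xf) => xE; have := lt_le_trans xf c2.
  by rewrite -xE le_refl.
Qed.

(* [S] cuts every block into two parts that both contain an interval of
   witnesses, so a subset [E'] of [E] on one side leaves the witnesses on the
   other side untouched. *)
Lemma concentrated_split (I : set 'I_2) (A : 'I_2 -> set W) (E : set W) :
  (forall i, I i -> concentrated_in (A i) E i) ->
  exists S : set W, forall E', E' `<=` E -> E' `<=` S \/ E' `<=` ~` S ->
    forall i, I i -> concentrated_in (A i `\` E') E' i.
Proof.
move=> cA.
have /choice[h hP] : forall b, exists g, b ≺ g /\ forall i, I i ->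
    forall y, E y -> g ≼ y -> exists x, [/\ A i x, b ≼ x, x ≺ g & adj i x y].
  move=> b; have [|g gP] := evI (ev_gt b) (@ev_all_ord 1 (fun i g => I i ->
    forall y, E y -> g ≼ y -> exists x, [/\ A i x, b ≼ x, x ≺ g & adj i x y]) _).
    move=> i; have [Ii|nI] := pselect (I i); last by exists b.
    by apply: evS (cA i Ii b) => g gP _.
  by exists g; apply: gP; apply: le_refl.
have [S SP] := interval_splitting (fun b => (hP b).1).
exists S => E' E'E E'S i Ii b; have [[b1 bb1 b1S] [b2 bb2 b2S]] := SP b.
have [c [bc cE']] : exists c, b ≼ c /\ forall x, c ≼ x -> x ≺ h c -> ~ E' x.
  case: E'S => E'S; [exists b2|exists b1]; split=> // x cx xh /E'S.
    exact: b2S.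
  by apply; apply: b1S.
apply: evS (ev_gt (h c)) => g cg y E'y gy.
have [x [Ax cx xh xy]] := (hP c).2 i Ii y (E'E _ E'y) (le_trans (ltW cg) gy).
exists x; split=> //; [split=> //; exact: cE'|exact: le_trans cx|].
by apply: lt_le_trans xh _; apply: ltW.
Qed.

(** * Links, and partitions from ultrafilter classes *)

Definition linked_above i b x y :=
  exists2 p, path (adj i) x (rcons p y) & forall z, z \in p -> b ≺ z.

Lemma linked_above_trans i b x y z : b ≺ y ->
  linked_above i b x y -> linked_above i b y z -> linked_above i b x z.
Proof.
move=> by_ [p xp pb] [q yq qb]; exists (p ++ y :: q).
  by rewrite rcons_cat rcons_cons -cat_rcons cat_path xp last_rcons.
by move=> t; rewrite mem_cat inE => /or3P[/pb|/eqP->|/qb].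
Qed.

Lemma common_neighbour i b x y w :
  b ≺ w -> adj i x w -> adj i y w -> linked_above i b x y.
Proof.
move=> bw xw yw; exists [:: w]; first by rewrite /= xw adjC yw.
by move=> z; rewrite inE => /eqP->.
Qed.

Section Ultrafilter.
Variables (U : set_system W) (lab : W -> 'I_2).
Hypothesis ultraU : UltraFilter U.
Hypothesis evU : forall A, ev A -> U A.
Hypothesis labU : forall x, U [set y | adj (lab x) x y].

(** Both neighbourhoods in the shared color, [E] and every final segment belong to [U], so they
    meet. *)
Lemma common_neighbourU E b x y : U E -> lab x = lab y ->
  exists w, [/\ b ≺ w, E w, adj (lab x) x w & adj (lab x) y w].
Proof.
move=> UE xy; have Ux := labU x; have Uy := labU y; rewrite -xy in Uy.
have Ub := evU (ev_gt b).
have /filter_ex[w [[bw Ew] [xw yw]]] : U ([set w | b ≺ w] `&` E `&`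
    ([set w | adj (lab x) x w] `&` [set w | adj (lab x) y w])).
  by apply: filterI; apply: filterI.
by exists w.
Qed.

Lemma almost_joined_lab B i x : U B -> almost_joined B i x -> lab x = i.
Proof.
move=> UB /evU Ux.
have /filter_ex[w [[Bw xw] xw']] :
    U (B `&` [set y | B y -> adj i x y] `&` [set y | adj (lab x) x y]).
  by apply: filterI (labU x); apply: filterI.
exact: adj_inj xw' (xw Bw).
Qed.

(** [U] contains the half [E'] of [E] on one side of [S]: (1) holds through common neighbours in
    [E'], and (2) survives the splitting. *)
Lemma partition_ultrafilter E : U E ->
  (forall i, concentrated_in [set x | lab x = i] E i) -> partitionable adj.
Proof.
move=> UE cE; have [S SP] := @concentrated_split setT _ E (fun i _ => cE i).
have [E' [UE' E'E E'S]] : exists E', [/\ U E', E' `<=` E & E' `<=` S \/ E' `<=` ~` S].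
  case: (in_ultra_setVsetC S ultraU) => US; [exists (E `&` S)|exists (E `&` ~` S)];
    by split; [exact: filterI|move=> x []|by [left => x []|right => x []]].
apply: (@path_partition adj lab E') => //.
- move=> /evU UnE'; have /filter_ex[x [? []]] // : U (E' `&` ~` E').
  exact: filterI.
- move=> b x y xy _; have [w [bw E'w xw yw]] := common_neighbourU b UE' xy.
  exists [:: w]; split; first by rewrite /= xw adjC yw.
  by move=> z; rewrite inE => /eqP->; auto.
- move=> i _ b; apply: evS (SP _ E'E E'S i I b) => g gP y Ey gy.
  by have [x [[? ?] ? ? ?]] := gP y Ey gy; exists x.
Qed.

End Ultrafilter.

(** Below [b0], points of uncountable [j]-degree are linked through a neighbour beyond [b0]. The
    others are joined to almost all points in the other color, so any two of them have common
    neighbours in [E']. *)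
Lemma partition_linked j b0 (E : set W) : ~ ev (~` E) ->
  concentrated_in [set x | b0 ≼ x] E j ->
  (forall b x y, b0 ≼ x -> b0 ≼ y -> x <> y -> linked_above j b x y) ->
  partitionable adj.
Proof.
move=> unbE cE lnk.
have [|S SP] := @concentrated_split [set j] (fun=> [set x | b0 ≼ x]) E.
  by move=> i ->.
have [E' [unbE' E'E E'S]] : exists E',
    [/\ ~ ev (~` E'), E' `<=` E & E' `<=` S \/ E' `<=` ~` S].
  have [eS|neS] := pselect (ev (~` (E `&` S))); last first.
    exists (E `&` S); split; [by []|by move=> x []|by left=> x []].
  exists (E `\` S); split=> [eS'||]; [|by move=> x []|by right=> x []].
  apply: unbE; apply: evS (evI eS eS') => x [nES nEnS] Ex.
  by have [Sx|nSx] := pselect (S x); [apply: nES|apply: nEnS].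
pose poor x := ev (fun y => ~~ adj j x y).
pose lab x := if `[< x ≺ b0 /\ poor x >] then rev_ord j else j.
have lab_ge x : b0 ≼ x -> lab x = j.
  by move=> bx; rewrite /lab; case: asboolP => // -[]; rewrite bx.
have lab_rev x : lab x = rev_ord j -> poor x.
  by rewrite /lab; case: asboolP => [[]//|_ /esym/rev_neq].
have nbr b x : lab x = j -> x ≺ b0 -> exists2 y, adj j x y & b ≺ y.
  rewrite /lab; case: asboolP => [_ /rev_neq //|nP _ xb0].
  have [|y xy by_] := @unbounded_gt [set y | adj j x y] _ b; last by exists y.
  by move=> eP; apply: nP; split=> //; apply: evS eP => y /= /negP.
have link1 b x y : adj j x y -> linked_above j b x y.
  by move=> xy; exists [::]; rewrite //= xy.
have lnk1 b x y : lab x = j -> b0 ≼ y -> x <> y -> linked_above j b x y.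
  move=> lx b0y xy; have [b0x|xb0] := boolP (R b0 x); first exact: lnk.
  have [c cP] := ev_above_seq b [:: b; b0; y]; have {}cP := cP c (le_refl c).
  have [z xz cz] := nbr c x lx xb0.
  have below t : t \in [:: b; b0; y] -> t ≺ z.
    by move=> /cP /ltW tc; apply: le_lt_trans cz.
  apply: (linked_above_trans (y := z)); first by apply: below; rewrite !inE eqxx.
    exact: link1.
  apply: lnk => //; first by apply/ltW/below; rewrite !inE eqxx orbT.
  have yz : y ≺ z by apply: below; rewrite !inE eqxx !orbT.
  by move=> zy; move: yz; rewrite zy le_refl.
have lnk2 b x y : lab x = j -> lab y = j -> x <> y -> linked_above j b x y.
  move=> lx ly xy; have [b0y|yb0] := boolP (R b0 y); first exact: lnk1.
  have [c cP] := ev_above_seq b [:: b; b0; x]; have {}cP := cP c (le_refl c).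
  have [z yz cz] := nbr c y ly yb0.
  have below t : t \in [:: b; b0; x] -> t ≺ z.
    by move=> /cP /ltW tc; apply: le_lt_trans cz.
  apply: (linked_above_trans (y := z)); first by apply: below; rewrite !inE eqxx.
    apply: lnk1 => //; first by apply/ltW/below; rewrite !inE eqxx orbT.
    have xz : x ≺ z by apply: below; rewrite !inE eqxx !orbT.
    by move=> zx; move: xz; rewrite zx le_refl.
  by apply: link1; rewrite adjC.
apply: (@path_partition adj lab E') => //.
- move=> b x y lxy xy; case: (color_case j (lab x)) => lx.
    have [c cP] := ev_above_seq b [:: b; b0]; have {}cP := cP c (le_refl c).
    have [|p xp pP] := @lnk2 c x y lx _ xy; first by rewrite -lxy.
    exists p; rewrite lx; split=> // z /pP cz.
    have below t : t \in [:: b; b0] -> t ≺ z.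
      by move=> /cP /ltW tc; apply: le_lt_trans cz.
    split; first by apply: below; rewrite !inE eqxx.
    by right; apply/lab_ge/ltW/below; rewrite !inE eqxx orbT.
  have Px := lab_rev x lx; have Py : poor y by apply: lab_rev; rewrite -lxy.
  have [c cP] := evI Px (evI Py (evI (ev_gt b) (evI (ev_gt x) (ev_gt y)))).
  have [w E'w /ltW cw] := unbounded_gt unbE' c.
  have [xw [yw [bw [xltw yltw]]]] := cP w cw.
  exists [:: w]; split; last by move=> z; rewrite inE => /eqP->; auto.
  rewrite /= lx adj_total //=; last by move=> E0; move: xltw; rewrite E0 le_refl.
  rewrite adjC adj_total //.
  by move=> E0; move: yltw; rewrite E0 le_refl.
- move=> i ai b; case: (color_case j i) => ij.
    rewrite ij; apply: evS (SP _ E'E E'S j erefl b) => g gP y Ey gy.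
    have [x [[b0x nE'x] bx xg xy]] := gP y Ey gy.
    by exists x; split=> //; apply: lab_ge.
  (* The other class lies below [b0], so (2) concerns [j] only. *)
  by case: ai; exists b0 => x b0x; rewrite (lab_ge _ b0x) ij => /esym/rev_neq.
Qed.

(** * Case analysis for an arbitrary coloring *)

Lemma coloring_partitionable : partitionable adj.
Proof.
have lab_ex U : UltraFilter U -> (forall A : set W, ev A -> U A) ->
    exists lab : W -> 'I_2, forall x, U [set y | adj (lab x) x y].
  move=> UU evU.
  suff /choice[lab labP] : forall x, exists i, U [set y | adj i x y] by exists lab.
  move=> x; have [U0|Un0] := in_ultra_setVsetC [set y | adj ord0 x y] UU.
    by exists ord0.
  exists (rev_ord ord0); apply: filterS (filterI Un0 (evU _ (ev_gt x))) => y [/= n0 xy].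
  by apply: adj_total; [move=> xE; move: xy; rewrite xE le_refl|apply/negP].
have ge_unb (A : set W) c : ~ ev (~` A) -> ~ ev (~` [set x | A x /\ c ≼ x]).
  move=> unbA /(evI (ev_gt c)) e; apply: unbA; apply: evS e => x [/ltW cx nA] Ax.
  exact: nA.
have [[j [B [A0 [unbB unbA0 A0B]]]]|noB] := pselect (exists j (B A0 : set W),
    [/\ ~ ev (~` B), ~ ev (~` A0) & forall x, A0 x -> almost_joined B j x]).
  have [U [UU evU UB]] := uniform_ultrafilter unbB.
  have [lab labU] := lab_ex U UU evU.
  have lab0 x : A0 x -> lab x = j.
    by move=> /A0B; apply: (almost_joined_lab UU evU labU UB).
  have [cj|] := pselect (concentrated_in [set x | lab x = rev_ord j] B (rev_ord j)).
    apply: (partition_ultrafilter UU evU labU UB) => i.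
    case: (color_case j i) => -> //.
    by apply: concentratedS (almost_joined_concentrated unbA0 A0B).
  (* Late points of the other class are now almost joined to [B'] in color [j], so [j] links
     everything beyond [b0]. *)
  move=> /not_concentrated[B' [b0 [B'B unbB' B'P]]].
  rewrite rev_ordK in B'P.
  have A0B' x : A0 x -> almost_joined B' j x.
    by move=> /A0B; apply: evS => y BA /B'B.
  apply: (@partition_linked j b0 B' unbB').
    apply: concentratedS (concentrated_ge b0 (almost_joined_concentrated unbA0 A0B')).
    by move=> x [].
  have nbrU b x y : lab x = j -> lab y = j -> linked_above j b x y.
    move=> lx ly; have [|w [bw _]] :=
      common_neighbourU UU evU labU b UB (x := x) (y := y).
      by rewrite lx.
    by rewrite lx => xw yw; apply: common_neighbour bw xw yw.
  have nbrB b x y : almost_joined B' j x -> almost_joined B' j y -> linked_above j b x y.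
    move=> xB yB; have [c cP] := evI (ev_gt b) (evI xB yB).
    have [w B'w /ltW cw] := unbounded_gt unbB' c.
    have [bw [/(_ B'w) xw /(_ B'w) yw]] := cP w cw.
    exact: common_neighbour bw xw yw.
  (* [q] is both labelled [j] and almost joined to [B'], so it mediates between the two kinds of
     points. *)
  move=> b x y bx by_ xy; have [q A0q bq] := unbounded_gt unbA0 b.
  case: (color_case j (lab x)) => lx; case: (color_case j (lab y)) => ly.
  + exact: nbrU.
  + by apply: (linked_above_trans bq); [apply: nbrU; auto|apply: nbrB; auto].
  + by apply: (linked_above_trans bq); [apply: nbrB; auto|apply: nbrU; auto].
  + by apply: nbrB; auto.
have unbT : ~ ev (~` [set: W]) by move=> [b /(_ b (le_refl b))]; apply.
have [U [UU evU UT]] := uniform_ultrafilter unbT.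
have [lab labU] := lab_ex U UU evU.
(* A failure would produce the two sets excluded by [noB]. *)
have conc i : ~ ev (~` [set x | lab x = i]) -> concentrated_in [set x | lab x = i] setT i.
  move=> unbi; apply: contrapT => /not_concentrated[B [b [_ unbB BP]]].
  apply: noB; exists (rev_ord i), B, [set x | lab x = i /\ b ≼ x]; split=> //.
    exact: ge_unb.
  by move=> x [lx bx]; apply: BP.
have [cl|/existsNP[i ni]] := pselect (forall i, ~ ev (~` [set x | lab x = i])).
  by apply: (partition_ultrafilter UU evU labU UT) => i; apply: conc.
(* One class is countable, so a final segment carries the other label throughout. *)
have [b bP] := contrapT ni.
have lab_ge x : b ≼ x -> lab x = rev_ord i.
  by move=> /bP; case: (color_case i (lab x)).
apply: (@partition_linked (rev_ord i) b setT unbT).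
  apply: concentratedS (concentrated_ge b (conc (rev_ord i) _)); first by move=> x [].
  move=> ei; have [c cP] := evI ei (ev_gt b).
  by have [nc /ltW bc] := cP c (le_refl c); apply: nc; apply: lab_ge.
move=> c x y bx by_ xy; have [|w [cw _]] :=
  common_neighbourU UU evU labU c UT (x := x) (y := y).
  by rewrite !lab_ge.
by rewrite lab_ge // => xw yw; apply: common_neighbour cw xw yw.
Qed.

End Coloring.

End Omega1.

(** * Transfer to edge colorings *)

Unset Implicit Arguments.
Set Strict Implicit.

Theorem theorem5p3 (W : Type) (R : rel W) (hR : omega1_order R)
    (c : edges (complete_graph W) -> 'I_2) :
  exists P : 'I_2 -> set W,
    [/\ \bigcup_(i in [set: 'I_2]) P i = [set: W],
        trivIset [set: 'I_2] P
      & forall i : 'I_2, path_in_color c i (P i)].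
Proof.
(* [c] is defined on edges only, so adjacency asks for an edge with underlying pair {x, y}; this
   excludes loops. *)
pose adj (i : 'I_2) (x y : W) :=
  `[< exists2 e : edges (complete_graph W), c e = i & val e = [set x; y] >].
have adjC i x y : adj i x y = adj i y x by rewrite /adj setUC.
have adj_inj i j x y : adj i x y -> adj j x y -> i = j.
  by move=> /asboolP[e <- eE] /asboolP[f <- fE]; congr c; apply: val_inj; rewrite eE.
have adj_total i x y : x <> y -> ~~ adj i x y -> adj (rev_ord i) x y.
  move=> xy nxy; have eP : [set x; y] \in edges (complete_graph W).
    by rewrite inE; exists x, y.
  pose e : edges (complete_graph W) := exist _ [set x; y] eP.
  apply/asboolP; exists e => //.
  have : c e <> i by move=> ce; move/negP: nxy; apply; apply/asboolP; exists e.
  case: (c e) i {nxy} => [[|[|?]] ?] [[|[|?]] ?] // ne; apply/val_inj => //=;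
    by case: ne; apply/val_inj.
have [P PP] := @coloring_partitionable {classic W} R hR adj adjC adj_total adj_inj.
exists (fun i => [set x | P x = i]); split.
- by apply/seteqP; split=> // x _; exists (P x).
- by move=> i j _ _ [x [<- <-]].
move=> i; have [le [wo cf]] := PP i; exists le; split=> // v Pv; split.
  by move=> w [[]].
move=> b [Pb bv]; have [w [Pw wv /asboolP[e ce eE] bw]] := cf v b Pv Pb bv.
exists w => //; split=> //; split=> //; split; last by exists e.
exists v, w; split=> //; by case: wv => _ /nesym.
Qed.
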